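(* Let $h$ denote the ${\rm P}_{\rm III'}$ Hamiltonian with parameters $\mathbf v=(0,0)$ and independent variable $t$, and let $H$ denote the ${\rm P}_{\rm III'}$ Hamiltonian with parameters $\mathbf v=(-1,0)$ and independent variable $T$. The canonical variables of the ${\rm P}_{\rm III'}$ Hamiltonian system $\{q,p;t,h\}$ with $\mathbf v=(0,0)$ are related to those of the ${\rm P}_{\rm III'}$ Hamiltonian system $\{Q,P;T,H\}$ with $\mathbf v=(-1,0)$ by the canonical transformation $$T=\tfrac14 t,\qquad Q=\frac{i\sqrt t}{2}\left(\sqrt p+\sqrt{p-1}\right),\qquad P=\frac{i}{\sqrt t}\,\frac{\tfrac12+q\sqrt p\sqrt{p-1}-i\sqrt t\sqrt p}{\sqrt p+\sqrt{p-1}} .$$ That is, if $(q(t),p(t))$ is a solution of the Hamilton equations for $\mathbf v=(0,0)$, then $(Q(T),P(T))$ defined by these formulas is a solution of the Hamilton equations (in the variable $T$) for $\mathbf v=(-1,0)$. The inverse of this transformation is $$t=4T,\qquad q=-2TQ\,\frac{2Q^2-4Q^2P-Q-2T}{(Q^2+T)(Q^2-T)},\qquad p=-\frac{(Q^2-T)^2}{4TQ^2}.$$ That is, substituting the first set of formulas into the second returns $(t,q,p)$; conversely, if $(Q(T),P(T))$ is a solution of the Hamilton equations for $\mathbf v=(-1,0)$, then $(q(t),p(t))$ given by the second set of formulas is a solution of the Hamilton equations for $\mathbf v=(0,0)$, and the first set of formulas, for a suitable choice of the branches of the square roots, returns $(T,Q,P)$.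
   Context: For parameters $\mathbf v=(v_1,v_2)\in\mathbb C^2$, the ${\rm P}_{\rm III'}$ Hamiltonian system $\{q,p;t,H\}$ has the Hamiltonian $H=H(q,p;t;\mathbf v)$ given by $$tH=q^2p^2-(q^2+v_1q-t)p+\tfrac12(v_1+v_2)q,$$ and Hamilton equations $q'=\partial H/\partial p$, $p'=-\partial H/\partial q$ (with $'=d/dt$), i.e. $$tq'=2q^2p-q^2-v_1q+t,\qquad tp'=-2qp^2+(2q+v_1)p-\tfrac12(v_1+v_2).$$ The same formulas with $(q,p,t)$ replaced by $(Q,P,T)$ and $'=d/dT$ define the system $\{Q,P;T,H\}$. Here $(q(t),p(t))$ are complex analytic functions on a domain of $\mathbb C\setminus\{0\}$ on which analytic branches of $\sqrt t,\sqrt p,\sqrt{p-1}$ are fixed; each of these symbols denotes the same branch throughout the formulas. The formulas are understood generically: where $t,p,p-1$ are nonzero and, in the inverse direction, where $T$, $Q$, $Q^2-T$, $Q^2+T$ are nonzero. ''Canonical transformation'' means a transformation carrying the Hamilton equations of one system to the Hamilton equations of the other (the independent variable is also rescaled). *)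

(* Defs.v *)
From HB Require Import structures.
From mathcomp Require Import all_boot all_order all_algebra complex.
From mathcomp Require Import all_classical all_reals all_analysis.
Set Implicit Arguments.
Unset Strict Implicit.
Unset Printing Implicit Defensive.
Import Order.TTheory GRing.Theory Num.Theory.
Import numFieldNormedType.Exports.
Local Open Scope classical_set_scope.
Local Open Scope ring_scope.

(* The field of complex numbers over R, packed so that it carries the topology
   and the normed-module structure of a [numClosedFieldType]; differentiability
   over it is complex differentiability. *)
Definition Cplx (R : realType) : numClosedFieldType := R[i].

Section PIII'.
Variable C : numClosedFieldType.

Definition punctured_domain (D : set C) : Prop :=
  [/\ open D, connected D, D !=set0 & ~ D 0].

Definition analytic_on (D : set C) (f : C -> C) : Prop :=
  forall z, D z -> derivable f z 1.

Definition sqrt_branch (D : set C) (f s : C -> C) : Prop :=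
  analytic_on D s /\ forall z, D z -> s z ^+ 2 = f z.

Definition Ham (v : C * C) (q p t : C) : C :=
  (q ^+ 2 * p ^+ 2 - (q ^+ 2 + v.1 * q - t) * p + 2^-1 * (v.1 + v.2) * q) / t.

Definition hamilton_at (v : C * C) (q p : C -> C) (t : C) : Prop :=
  is_derive t 1 q (derive1 (fun y => Ham v (q t) y t) (p t)) /\
  is_derive t 1 p (- derive1 (fun x => Ham v x (p t) t) (q t)).

(* Differentiability at every point of the open set D is part of
   [hamilton_at], so q and p are analytic on D. *)
Definition solution (v : C * C) (D : set C) (q p : C -> C) : Prop :=
  punctured_domain D /\ forall t, D t -> hamilton_at v q p t.

(* The forward formulas; st, sp, sp1 stand for the values of the chosen
   branches of sqrt t, sqrt p, sqrt (p - 1). *)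
Definition T_of (t : C) : C := 4^-1 * t.

Definition Q_of (st sp sp1 : C) : C := 'i * st / 2 * (sp + sp1).

Definition P_of (q st sp sp1 : C) : C :=
  'i / st * ((2^-1 + q * sp * sp1 - 'i * st * sp) / (sp + sp1)).

Definition t_of (T : C) : C := 4 * T.

Definition q_of (T Q P : C) : C :=
  - 2 * T * Q * ((2 * Q ^+ 2 - 4 * Q ^+ 2 * P - Q - 2 * T)
                 / ((Q ^+ 2 + T) * (Q ^+ 2 - T))).

Definition p_of (T Q : C) : C :=
  - ((Q ^+ 2 - T) ^+ 2 / (4 * T * Q ^+ 2)).

(* The loci on which the forward, resp. inverse, formulas are meaningful. *)
Definition generic_tp (t p : C) : Prop := [/\ t != 0, p != 0 & p - 1 != 0].

Definition generic_TQ (T Q : C) : Prop :=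
  [/\ T != 0, Q != 0, Q ^+ 2 - T != 0 & Q ^+ 2 + T != 0].

End PIII'.

(* Main.v *)
(* Put r = i sqrt t, a square root of -t, and u = sqrt p + sqrt (p - 1). Since
   (sqrt p)^2 - (sqrt (p - 1))^2 = 1, the difference sqrt p - sqrt (p - 1) is
   1 / u, so t, p, sqrt p and sqrt (p - 1) are rational in r and u, and
   Q = r u / 2. A square root s of f has s' = f' / (2 s), so differentiating the
   forward formulas turns each Hamilton equation into a rational identity in r,
   u and q; the backward formulas are rational in T, Q and P from the start. The
   branches that recover (Q, P) are forced by sqrt p + sqrt (p - 1) = 2 Q / r
   and sqrt p - sqrt (p - 1) = r / (2 Q). *)
Require Import Defs.
From HB Require Import structures.
From mathcomp Require Import all_boot all_order all_algebra complex ring.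
From mathcomp Require Import all_classical all_reals all_analysis.
Import Order.TTheory GRing.Theory Num.Theory.
Import numFieldNormedType.Exports.
Local Open Scope classical_set_scope.
Local Open Scope ring_scope.

Set Implicit Arguments.
Unset Strict Implicit.
Unset Printing Implicit Defensive.

(** * Derivative rules with values written in ring operations *)

Section Derivatives.
Variable K : numFieldType.
Implicit Types (f g : K -> K) (x df dg c : K).

Lemma is_derive_add f g x df dg : is_derive x 1 f df -> is_derive x 1 g dg ->
  is_derive x 1 (fun z => f z + g z) (df + dg).
Proof. exact: is_deriveD. Qed.

Lemma is_derive_opp f x df : is_derive x 1 f df ->
  is_derive x 1 (fun z => - f z) (- df).
Proof. exact: is_deriveN. Qed.

Lemma is_derive_mul f g x df dg : is_derive x 1 f df -> is_derive x 1 g dg ->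
  is_derive x 1 (fun z => f z * g z) (df * g x + f x * dg).
Proof.
move=> hf hg; apply: (is_derive_eq (is_deriveM hf hg)).
by rewrite /GRing.scale /= addrC (mulrC df).
Qed.

Lemma is_derive_sqr f x df : is_derive x 1 f df ->
  is_derive x 1 (fun z => f z ^+ 2) (2 * f x * df).
Proof.
move=> hf; have -> : (fun z => f z ^+ 2) = (fun z => f z * f z).
  by apply/funext => z; rewrite expr2.
by apply: (is_derive_eq (is_derive_mul hf hf)); ring.
Qed.

Lemma is_derive_inv f x df : f x != 0 -> is_derive x 1 f df ->
  is_derive x 1 (fun z => (f z)^-1) (- df / f x ^+ 2).
Proof.
move=> fx0 [hf <-]; split; first exact: derivableV.
by rewrite deriveV // /GRing.scale /= mulNr mulrC mulNr.
Qed.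

Lemma is_derive_const c x : is_derive x 1 (fun _ : K => c) 0.
Proof. exact: is_derive_cst. Qed.

Lemma is_derive_var x : is_derive x 1 (fun z : K => z) 1.
Proof. exact: is_derive_id. Qed.

Lemma is_derive_chain f g x df dg :
  is_derive (g x) 1 f df -> is_derive x 1 g dg ->
  is_derive x 1 (fun z => f (g z)) (df * dg).
Proof.
move=> [/derivable1_diffP hf <-] [/derivable1_diffP hg <-].
have hfg := differentiable_comp hg hf.
change (is_derive x 1 (f \o g) ('D_1 f (g x) * 'D_1 g x)).
split; first exact/derivable1_diffP.
(* The increment ['d g x 1] is read as itself times 1, so linearity of the differential of [f] pulls
   it out as a factor. *)
rewrite deriveE // diff_comp // [LHS]/= -[X in 'd f _ X]mulr1 [LHS]linearZ.
by rewrite /= /GRing.scale /= mulrC !deriveE.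
Qed.

End Derivatives.

(* [notypeclasses refine] prevents class resolution from closing the goals with
   the library instances, whose derivatives are written with [*:], which [field]
   does not normalise. *)
Ltac derive_rules := first
  [ eassumption
  | notypeclasses refine (is_derive_const _ _)
  | notypeclasses refine (is_derive_var _)
  | notypeclasses refine (is_derive_add _ _); derive_rules
  | notypeclasses refine (is_derive_opp _); derive_rules
  | notypeclasses refine (is_derive_sqr _); derive_rules
  | notypeclasses refine (is_derive_mul _ _); derive_rules
  | notypeclasses refine (is_derive_inv _ _); [ | derive_rules] ].

Ltac compute_derive :=
  notypeclasses refine (is_derive_eq _ _); [derive_rules | cbv beta].

Section Transformation.
Variable C : numClosedFieldType.
Implicit Types (D : set C) (v : C * C) (q p s f : C -> C) (t a b c : C).

(** * Explicit Hamilton equations, square roots and rescaled domains *)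

Lemma hamilton_atE v q p t : t != 0 ->
  hamilton_at v q p t <->
  is_derive t 1 q ((2 * q t ^+ 2 * p t - q t ^+ 2 - v.1 * q t + t) / t) /\
  is_derive t 1 p ((- 2 * q t * p t ^+ 2 + (2 * q t + v.1) * p t
                    - (v.1 + v.2) / 2) / t).
Proof.
move=> t0; rewrite /hamilton_at !derive1E.
have h1 : is_derive (p t) 1 (fun y => Ham v (q t) y t)
    ((2 * q t ^+ 2 * p t - q t ^+ 2 - v.1 * q t + t) / t).
  by rewrite /Ham; compute_derive; field.
have h2 : is_derive (q t) 1 (fun x => Ham v x (p t) t)
    (- ((- 2 * q t * p t ^+ 2 + (2 * q t + v.1) * p t
                    - (v.1 + v.2) / 2) / t)).
  by rewrite /Ham; compute_derive; field.
by rewrite !(derive_val, opprK).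
Qed.

(** Since [D] is open, [s ^+ 2 = f] holds near [t], and uniqueness of the derivative gives
    [df = 2 * s t * s']; [f t != 0] allows dividing by [s t]. *)
Lemma is_derive_sqrt D f s t df : open D -> D t -> sqrt_branch D f s ->
  f t != 0 -> is_derive t 1 f df -> is_derive t 1 s (df / (2 * s t)).
Proof.
move=> oD Dt [sD s2] ft0 hf.
have hs : is_derive t 1 s ('D_1 s t) by apply: DeriveDef => //; exact: sD.
have hs2 : is_derive t 1 f (2 * s t * 'D_1 s t).
  apply: near_eq_is_derive (is_derive_sqr hs).
  by near=> z; apply: s2; near: z; exact: open_nbhs_nbhs.
have st0 : s t != 0 by apply: contraNneq ft0 => st0; rewrite -s2 // st0 expr0n.
apply: (is_derive_eq hs).
have -> : df = 2 * s t * 'D_1 s t by case: hf => _ <-; case: hs2 => _ <-.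
by field.
Unshelve. all: by end_near. Qed.

Lemma punctured_domain_scale D c : c != 0 -> punctured_domain D ->
  punctured_domain [set t | D (c * t)].
Proof.
move=> c0 [oD cD [x Dx] D0].
have cont k : continuous (fun z : C => k * z) by move=> z; exact: mulrl_continuous.
split.
- by apply: open_comp => // z _; exact: cont.
(* Connectedness passes to continuous images, so the preimage is rewritten as an image under the
   inverse scaling. *)
- have -> : [set t | D (c * t)] = (fun z => c^-1 * z) @` D.
    apply/seteqP; split=> z /=.
      by move=> Dz; exists (c * z) => //; rewrite mulKf.
    by move=> [y Dy <-]; rewrite mulVKf.
  apply: connected_continuous_connected => //.
  exact/continuous_subspaceT/cont.
- by exists (c^-1 * x); rewrite /= mulVKf.
- by rewrite /= mulr0.
Qed.

(** * Rational parametrisation by r and u *)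

Lemma sqrt_branch_Ni D s : sqrt_branch D (fun t => t) s ->
  sqrt_branch D (fun t => - t) (fun t => 'i * s t).
Proof.
move=> [sD s2]; split=> z Dz; last by rewrite exprMn sqrCi s2 // mulN1r.
have hs : is_derive z 1 s ('D_1 s z) by apply: DeriveDef => //; exact: sD.
by case: (is_derive_mul (is_derive_const 'i z) hs).
Qed.

(** As 1/i = -i, the imaginary unit enters only through r = i sqrt t, so [field] can treat r as an
    atom. *)
Lemma P_of_Ni (q t a b : C) : P_of q t a b =
  - ('i * t)^-1 * ((2^-1 + q * a * b - 'i * t * a) / (a + b)).
Proof. by rewrite /P_of invfM invCi; ring. Qed.

(** Take u = a + b, whose inverse is a - b. Then u^2 + 1 = 2au and u^2 - 1 = 2bu, so the last two
    conditions encode p and p - 1 being nonzero. *)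
Lemma hyperbola_param a b : a != 0 -> b != 0 -> a ^+ 2 - b ^+ 2 = 1 ->
  exists u, [/\ a = (u + u^-1) / 2, b = (u - u^-1) / 2 &
                [/\ u != 0, u ^+ 2 + 1 != 0 & u ^+ 2 - 1 != 0]].
Proof.
move=> a0 b0 ab1; have uv : (a + b) * (a - b) = 1 by rewrite -ab1; ring.
have u0 : a + b != 0.
  by apply: contra_eq_neq uv => ->; rewrite mul0r eq_sym oner_eq0.
exists (a + b); have -> : (a + b)^-1 = a - b.
  by rewrite -[LHS]mulr1 -uv mulKf.
split; [by field | by field | split=> //].
- have -> : (a + b) ^+ 2 + 1 = 2 * a * (a + b)
    by rewrite -[X in _ + X = _]ab1; ring.
  by rewrite !mulf_neq0 // pnatr_eq0.
- have -> : (a + b) ^+ 2 - 1 = 2 * b * (a + b)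
    by rewrite -[X in _ - X = _]ab1; ring.
  by rewrite !mulf_neq0 // pnatr_eq0.
Qed.

Lemma sqrt_neq0 (s t : C) : s ^+ 2 = t -> t != 0 -> s != 0.
Proof. by move=> <-; rewrite expf_eq0. Qed.

(** * From v = (0,0) to v = (-1,0) *)

Lemma forward_solution D q p st sp sp1 :
  solution (0, 0) D q p ->
  (forall t, D t -> generic_tp t (p t)) ->
  sqrt_branch D (fun t => t) st ->
  sqrt_branch D p sp ->
  sqrt_branch D (fun t => p t - 1) sp1 ->
  solution (-1, 0) [set T | D (t_of T)]
    (fun T => Q_of (st (t_of T)) (sp (t_of T)) (sp1 (t_of T)))
    (fun T => P_of (q (t_of T)) (st (t_of T)) (sp (t_of T)) (sp1 (t_of T))).
Proof.
move=> [dD hqp] gen hst hsp hsp1.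
split; first by apply: punctured_domain_scale => //; rewrite pnatr_eq0.
move=> T /= DT; have [t0 p0 p10] := gen _ DT.
have oD : open D by case: dD.
have T0 : T != 0 by apply: contraNneq t0 => ->; rewrite /t_of mulr0.
have [hq hp] := (hamilton_atE (0, 0) q p t0).1 (hqp _ DT).
have hr := sqrt_branch_Ni hst.
have nt0 : - t_of T != 0 by rewrite oppr_eq0.
have dr := is_derive_sqrt oD DT hr nt0 (is_derive_opp (is_derive_var _)).
have da := is_derive_sqrt oD DT hsp p0 hp.
have db := is_derive_sqrt oD DT hsp1 p10
  (is_derive_add hp (is_derive_const (-1) (t_of T))).
(* The factor dt/dT of the chain rule: [Q_of] and [P_of] are differentiated in t first, then
   composed with [t_of]. *)
have scale : is_derive T 1 (@t_of C) 4.
  by rewrite /t_of; compute_derive; ring.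
apply/hamilton_atE => //.
have rE := hr.2 _ DT; have aE := hsp.2 _ DT; have bE := hsp1.2 _ DT.
have ab1 : sp (t_of T) ^+ 2 - sp1 (t_of T) ^+ 2 = 1 by rewrite aE bE; ring.
have r0 : 'i * st (t_of T) != 0 by apply: sqrt_neq0 rE _; rewrite oppr_eq0.
have a0 := sqrt_neq0 aE p0.
have b0 := sqrt_neq0 bE p10.
have [u [au bu [u0 up0 um0]]] := hyperbola_param a0 b0 ab1.
have abu : sp (t_of T) + sp1 (t_of T) = u by rewrite au bu; field.
have tE : t_of T = - ('i * st (t_of T)) ^+ 2 by rewrite rE opprK.
have TE : T = - ('i * st (t_of T)) ^+ 2 / 4 by rewrite -tE /t_of; field.
split.
- notypeclasses refine (is_derive_eq
    (is_derive_chain (f := fun t => Q_of (st t) (sp t) (sp1 t)) _ scale) _).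
    by rewrite /Q_of; derive_rules.
  rewrite P_of_Ni /Q_of -aE /=.
  (* Abstracting the function values leaves, once t, T, a and b are eliminated, a rational identity
     in r, u and the value of q. *)
  move: (t_of T) ('i * st _) (sp _) (sp1 _) (q _) au bu r0 abu tE TE a0 b0.
  move=> t r a b y au bu r0 abu tE TE a0 b0.
  rewrite abu TE tE au bu; field.
  by rewrite r0 u0 up0 um0.
- have PE : (fun t => P_of (q t) (st t) (sp t) (sp1 t)) =
      (fun t => - ('i * st t)^-1 *
        ((2^-1 + q t * sp t * sp1 t - 'i * st t * sp t) / (sp t + sp1 t))).
    by apply/funext => z; exact: P_of_Ni.
  notypeclasses refine (is_derive_eq (is_derive_chain
    (f := fun t => P_of (q t) (st t) (sp t) (sp1 t)) _ scale) _).
    by rewrite PE; derive_rules; rewrite ?abu.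
  rewrite P_of_Ni /Q_of -aE /=.
  move: (t_of T) ('i * st _) (sp _) (sp1 _) (q _) au bu r0 abu tE TE a0 b0.
  move=> t r a b y au bu r0 abu tE TE a0 b0.
  rewrite abu TE tE au bu; field.
  by rewrite r0 u0 up0 um0.
Qed.

(** * The backward formulas undo the forward ones *)

Lemma inverse_forward (t q p st sp sp1 : C) :
  generic_tp t p -> st ^+ 2 = t -> sp ^+ 2 = p -> sp1 ^+ 2 = p - 1 ->
  let T := T_of t in
  let Q := Q_of st sp sp1 in
  let P := P_of q st sp sp1 in
  generic_TQ T Q /\ [/\ t_of T = t, q_of T Q P = q & p_of T Q = p].
Proof.
move=> [t0 p0 p10] stE aE bE.
set r := 'i * st; have tE : t = - r ^+ 2 by rewrite exprMn sqrCi stE; ring.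
have r0 : r != 0 by apply: contraNneq t0 => r0; rewrite tE r0 expr0n oppr0.
have a0 := sqrt_neq0 aE p0; have b0 := sqrt_neq0 bE p10.
rewrite /Q_of P_of_Ni -/r; clearbody r.
have ab1 : sp ^+ 2 - sp1 ^+ 2 = 1 by rewrite aE bE; ring.
have [u [au bu [u0 up0 um0]]] := hyperbola_param a0 b0 ab1.
rewrite -aE /T_of /t_of /generic_TQ /q_of /p_of tE au bu.
have uE : (u + u^-1) / 2 + (u - u^-1) / 2 = u by field.
rewrite uE.
(* These are Q^2 - T and Q^2 + T: their zeros would be those of p and p - 1 respectively. *)
have e1 : (r / 2 * u) ^+ 2 - 4^-1 * - r ^+ 2 = r ^+ 2 * (u ^+ 2 + 1) / 4
  by field.
have e2 : (r / 2 * u) ^+ 2 + 4^-1 * - r ^+ 2 = r ^+ 2 * (u ^+ 2 - 1) / 4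
  by field.
have nz := (mulf_eq0, invr_eq0, sqrf_eq0, pnatr_eq0, negb_or).
rewrite e1 e2; split; split.
- by rewrite mulrN oppr_eq0 !nz r0.
- by rewrite !nz r0 u0.
- by rewrite !nz r0 up0.
- by rewrite !nz r0 um0.
- by field.
- by field; rewrite r0 u0 um0 up0.
- by field; rewrite u0 r0.
Qed.

(** * From v = (-1,0) back to v = (0,0) *)

Lemma generic_tp_of (T Q : C) : generic_TQ T Q -> generic_tp (t_of T) (p_of T Q).
Proof.
move=> [T0 Q0 m0 p0]; have nz := (mulf_eq0, invr_eq0, sqrf_eq0, pnatr_eq0, negb_or).
rewrite /generic_tp /p_of /t_of; split.
- by rewrite !nz.
- by rewrite oppr_eq0 !nz m0 T0 Q0.
- have -> : - ((Q ^+ 2 - T) ^+ 2 / (4 * T * Q ^+ 2)) - 1 =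
            - ((Q ^+ 2 + T) ^+ 2 / (4 * T * Q ^+ 2)) by field; rewrite T0 Q0.
  by rewrite oppr_eq0 !nz p0 T0 Q0.
Qed.

Lemma T_ofK (t : C) : t_of (T_of t) = t.
Proof. by rewrite /t_of /T_of; field. Qed.

Lemma t_ofK (T : C) : T_of (t_of T) = T.
Proof. by rewrite /t_of /T_of; field. Qed.

(** Differentiation is still in T, so the right-hand sides for v = (0,0) carry the factor dt/dT = 4;
    the divisor is T because 4/t = 1/T. *)
Lemma backward_derivatives (Q P : C -> C) (T : C) :
  generic_TQ T (Q T) -> hamilton_at (-1, 0) Q P T ->
  let q := q_of T (Q T) (P T) in let p := p_of T (Q T) in
  is_derive T 1 (fun T => q_of T (Q T) (P T))
    ((2 * q ^+ 2 * p - q ^+ 2 + t_of T) / T) /\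
  is_derive T 1 (fun T => p_of T (Q T)) ((- 2 * q * p ^+ 2 + 2 * q * p) / T).
Proof.
move=> [T0 Q0 m0 p0] /(hamilton_atE _ _ _ T0)[hQ hP] q p.
have nz := (mulf_eq0, invr_eq0, sqrf_eq0, pnatr_eq0, negb_or).
rewrite {}/q {}/p; split.
- rewrite {1}/q_of; compute_derive; first by rewrite !nz m0 p0.
  rewrite /q_of /p_of /t_of /=.
  move: (Q _) (P _) Q0 m0 p0 => y z Q0 m0 p0.
  by field; rewrite ?T0 ?Q0 ?m0 ?p0.
- rewrite {1}/p_of; compute_derive; first by rewrite !nz T0 Q0.
  rewrite /q_of /p_of /t_of /=.
  move: (Q _) (P _) Q0 m0 p0 => y z Q0 m0 p0.
  by field; rewrite ?T0 ?Q0 ?m0 ?p0.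
Qed.

Lemma backward_solution D (Q P : C -> C) :
  solution (-1, 0) D Q P ->
  (forall T, D T -> generic_TQ T (Q T)) ->
  solution (0, 0) [set t | D (T_of t)]
    (fun t => q_of (T_of t) (Q (T_of t)) (P (T_of t)))
    (fun t => p_of (T_of t) (Q (T_of t))).
Proof.
move=> [dD hQP] gen.
split.
  by apply: punctured_domain_scale => //; rewrite invr_eq0 pnatr_eq0.
move=> t /= Dt; have T0 : T_of t != 0 by case: (gen _ Dt).
have [dq dp] := backward_derivatives (gen _ Dt) (hQP _ Dt).
have scale : is_derive t 1 (@T_of C) 4^-1.
  by rewrite /T_of; compute_derive; ring.
have t0 : t != 0 by rewrite -(T_ofK t) /t_of mulf_neq0 // pnatr_eq0.
have TE : T_of t = t / 4 by rewrite /T_of mulrC.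
apply/hamilton_atE => //; split.
- apply: (is_derive_eq (is_derive_chain dq scale)) => /=.
  move: (q_of _ _ _) (p_of _ _) => q p; rewrite T_ofK TE.
  by field; rewrite ?t0.
- apply: (is_derive_eq (is_derive_chain dp scale)) => /=.
  move: (q_of _ _ _) (p_of _ _) => q p; rewrite TE.
  by field; rewrite ?t0.
Qed.

(** * Branches of the square roots recovering (Q, P) *)

Lemma backward_branches D (Q P : C -> C) (st : C -> C) :
  solution (-1, 0) D Q P ->
  (forall T, D T -> generic_TQ T (Q T)) ->
  sqrt_branch [set t | D (T_of t)] (fun t => t) st ->
  exists sp sp1 : C -> C,
    [/\ sqrt_branch [set t | D (T_of t)]
          (fun t => p_of (T_of t) (Q (T_of t))) sp,
        sqrt_branch [set t | D (T_of t)]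
          (fun t => p_of (T_of t) (Q (T_of t)) - 1) sp1 &
        forall T, D T ->
          Q_of (st (t_of T)) (sp (t_of T)) (sp1 (t_of T)) = Q T /\
          P_of (q_of T (Q T) (P T)) (st (t_of T)) (sp (t_of T))
            (sp1 (t_of T)) = P T].
Proof.
move=> [dD hQP] gen /sqrt_branch_Ni hr.
pose r t := 'i * st t.
(* This is (u + c/u)/2 with u = 2Q/r; c = 1 gives sqrt p and c = -1 gives sqrt (p - 1), so
   analyticity is proved once for both. *)
pose sp c t := Q (T_of t) / r t + c * (r t / (4 * Q (T_of t))).
have rE t : D (T_of t) -> T_of t = - r t ^+ 2 / 4.
  by move=> Dt; rewrite (hr.2 _ Dt) opprK /T_of mulrC.
have r0 t : D (T_of t) -> r t != 0.
  move=> Dt; have [T0 _ _ _] := gen _ Dt; apply: contraNneq T0 => r0.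
  by rewrite rE // r0 expr0n oppr0 mul0r.
have analytic_sp c : analytic_on [set t | D (T_of t)] (sp c).
  move=> t Dt; have [T0 Q0 _ _] := gen _ Dt.
  have [hQ _] := (hamilton_atE (-1, 0) Q P T0).1 (hQP _ Dt).
  have hr' : is_derive t 1 r ('D_1 r t) by apply: DeriveDef => //; exact: hr.1.
  have scale : is_derive t 1 (@T_of C) 4^-1.
    by rewrite /T_of; compute_derive; ring.
  have hQT := is_derive_chain hQ scale.
  (* Only differentiability matters; the derivative rules produce the value. *)
  suff [d] : exists d, is_derive t 1 (sp c) d by case.
  eexists; rewrite /sp; derive_rules; first exact: r0.
  by rewrite mulf_neq0 // pnatr_eq0.
exists (sp 1), (sp (-1)); split.
- split=> // t Dt; have [T0 Q0 m0 p0] := gen _ Dt.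
  rewrite /sp /p_of; have := r0 _ Dt; have := rE _ Dt.
  move: (T_of t) (Q _) (r t) T0 Q0 {m0 p0} => T y x T0 y0 -> x0.
  by field; rewrite ?x0 ?y0.
- split=> // t Dt; have [T0 Q0 m0 p0] := gen _ Dt.
  rewrite /sp /p_of; have := r0 _ Dt; have := rE _ Dt.
  move: (T_of t) (Q _) (r t) T0 Q0 {m0 p0} => T y x T0 y0 -> x0.
  by field; rewrite ?x0 ?y0.
- move=> T DT; have [T0 Q0 m0 p0] := gen _ DT.
  have := rE (t_of T); have := r0 (t_of T).
  rewrite P_of_Ni /Q_of /sp t_ofK -/(r _) => /(_ DT) x0 /(_ DT) TE.
  split; first by field; rewrite ?x0 ?Q0.
  rewrite /q_of.
  move: (r _) (Q T) (P T) x0 Q0 m0 p0 TE => x y z x0 y0 m0 p0 TE.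
  rewrite TE in m0 p0 *.
  (* The denominator of [P_of] collapses to u = 2Q/r, keeping the side conditions of [field]
     simple. *)
  have -> : y / x + 1 * (x / (4 * y)) + (y / x + -1 * (x / (4 * y))) = 2 * y / x.
    by field; rewrite x0 y0.
  field.
  (* With T = -r^2/4, the two denominators met by [field] are 4(Q^2 - T) and 4(Q^2 + T). *)
  have -> : y ^+ 2 * 4 - - x ^+ 2 = (y ^+ 2 - - x ^+ 2 / 4) * 4 by field.
  have -> : y ^+ 2 * 4 - x ^+ 2 = (y ^+ 2 + - x ^+ 2 / 4) * 4 by field.
  by rewrite x0 y0 !mulf_neq0 // pnatr_eq0.
Qed.

End Transformation.

Theorem proposition1 (R : realType) :
  (* solutions for v = (0,0) are carried to solutions for v = (-1,0) *)
  (forall (D : set (Cplx R)) (q p st sp sp1 : Cplx R -> Cplx R),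
     solution (0, 0) D q p ->
     (forall t, D t -> generic_tp t (p t)) ->
     sqrt_branch D (fun t => t) st ->
     sqrt_branch D p sp ->
     sqrt_branch D (fun t => p t - 1) sp1 ->
     solution (-1, 0) [set T | D (t_of T)]
       (fun T => let t := t_of T in Q_of (st t) (sp t) (sp1 t))
       (fun T => let t := t_of T in P_of (q t) (st t) (sp t) (sp1 t)))
  /\
  (* substituting the forward formulas into the inverse ones *)
  (forall t q p st sp sp1 : Cplx R,
     generic_tp t p ->
     st ^+ 2 = t -> sp ^+ 2 = p -> sp1 ^+ 2 = p - 1 ->
     let T := T_of t in
     let Q := Q_of st sp sp1 in
     let P := P_of q st sp sp1 in
     generic_TQ T Q /\ [/\ t_of T = t, q_of T Q P = q & p_of T Q = p])
  /\
  (* solutions for v = (-1,0) are carried back to solutions for v = (0,0), and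
     the forward formulas return them for suitable branches *)
  (forall (D : set (Cplx R)) (Q P : Cplx R -> Cplx R),
     solution (-1, 0) D Q P ->
     (forall T, D T -> generic_TQ T (Q T)) ->
     let D' := [set t | D (T_of t)] in
     let q := fun t => let T := T_of t in q_of T (Q T) (P T) in
     let p := fun t => let T := T_of t in p_of T (Q T) in
     solution (0, 0) D' q p /\
     (forall t, D' t -> generic_tp t (p t)) /\
     (forall st, sqrt_branch D' (fun t => t) st ->
        exists sp sp1 : Cplx R -> Cplx R,
          [/\ sqrt_branch D' p sp,
              sqrt_branch D' (fun t => p t - 1) sp1 &
              forall T, D T ->
                let t := t_of T in
                [/\ T_of t = T,
                    Q_of (st t) (sp t) (sp1 t) = Q T &
                    P_of (q t) (st t) (sp t) (sp1 t) = P T]])).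
Proof.
split=> [D q p st sp sp1|]; first exact: forward_solution.
split=> [t q p st sp sp1|D Q P sol gen D' q p]; first exact: inverse_forward.
split; first exact: backward_solution.
split=> [t Dt|st hst]; last first.
  have [sp [sp1 [hsp hsp1 E]]] := backward_branches sol gen hst.
  exists sp, sp1; split=> // T DT /=.
  by rewrite /q t_ofK; case: (E _ DT).
by rewrite -{1}(T_ofK t); exact/generic_tp_of/gen.
Qed.
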